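(* Let $k, n, r, s$ be non-negative integers with $n \geq r(k-1)+1$, $k > s \geq 0$ and $r \geq 2$. Then $$\chi\big(KG^{r}(n,k,s)\big) \geq \left\lceil \frac{n - r(k-s-1)}{r-1} \right\rceil.$$
   Context: For a positive integer $n$, $[n]=\{1,\ldots,n\}$. A hypergraph $\mathcal{H}=(V,E)$ consists of a finite vertex set $V$ and a set $E$ of non-empty subsets of $V$ (edges). A proper $m$-coloring of $\mathcal{H}$ is a map $c:V\to\{1,\ldots,m\}$ such that no edge is monochromatic, i.e. $|c(e)|\geq 2$ for every edge $e$. The chromatic number $\chi(\mathcal{H})$ is the least $m$ for which a proper $m$-coloring exists. The generalized Kneser hypergraph $KG^{r}(n,k,s)$ has as vertices all $k$-element subsets of $[n]$, and its edges are the sets $\{X_1,\ldots,X_r\}$ of $r$ distinct vertices such that $|X_i\cap X_j|\leq s$ for all $i\neq j$. *)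

(* Defs.v *)
From mathcomp Require Import all_boot.
Set Implicit Arguments. Unset Strict Implicit. Unset Printing Implicit Defensive.

Definition KG_vertex (n k : nat) (X : {set 'I_n}) : bool := #|X| == k.

Definition KG_edge (n k s r : nat) (E : {set {set 'I_n}}) : bool :=
  [&& #|E| == r,
      [forall X in E, KG_vertex k X] &
      [forall X in E, forall Y in E, (X != Y) ==> (#|X :&: Y| <= s)]].

(* A proper m-coloring of KG^r(n,k,s): a map c from vertices to {1..m}
   (modelled by 'I_m) such that no edge is monochromatic, i.e. every edge
   contains two vertices with distinct colours (|c(e)| >= 2).
   Values of c on non-vertices (subsets of size <> k) are irrelevant. *)
Definition KG_proper_coloring (n k s r m : nat) (c : {set 'I_n} -> 'I_m) : Prop :=
  forall E : {set {set 'I_n}}, KG_edge k s r E ->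
    exists X, exists Y, [/\ X \in E, Y \in E & c X != c Y].

(* Main.v *)
(* For a prime [p], a signed vector [X] on [n] with signs in Z_p assigns to the
   sign [a] those k-sets that meet the support of [X] inside [X^a] only and have
   at most [s] elements outside it; such a set exists once [X] has more than
   p(k-s-1) nonzero entries, because n >= p(k-1)+1.  Sets assigned to different
   signs along a chain of vectors share at most [s] elements, so in a proper
   m-coloring no colour gets all [p] signs along a chain.  The top colour of a
   chain and its nonempty proper set of signs then give a Z_p-equivariant
   monotone map from the chains of signed vectors, a twice subdivided n-fold
   join of Z_p, to the d-fold join of Z_p with d = p(k-s-1) + m(p-1).  Such a map
   forces n <= d: over F_p, cochains theta_j on the target with
   [delta theta_j = D theta_(j+1)], where [D] is alternately the norm and the
   difference operator of Z_p, are pulled back and paired with chains z_j such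
   that [boundary z_(j+1) = D z_j]; the pairings are all 1, while theta_n
   vanishes if d < n.

   For r = r1 r2, the bound for r1 inside the sets of a suitable size n' induces
   a colouring of the n'-sets, to which the bound for r2 applies. *)

Require Import Defs.
From mathcomp Require Import all_boot all_order all_algebra.
From mathcomp Require Import zify ring.
Set Implicit Arguments. Unset Strict Implicit. Unset Printing Implicit Defensive.
Import GRing.Theory.

(** * Cochains on sequences and subdivision *)

Section Coboundary.
Local Open Scope ring_scope.
Variable R : comNzRingType.

(** Simplicial coboundary: the alternating sum of [f] over the deletions of one entry. It is
    augmented, with value [f [::]] on a one-entry sequence. *)
Fixpoint cobd (T : Type) (f : seq T -> R) (s : seq T) : R :=
  if s is x :: s' then f s' - cobd (fun t => f (x :: t)) s' else 0.

Lemma eq_cobd (T : Type) (f g : seq T -> R) s : f =1 g -> cobd f s = cobd g s.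
Proof.
by elim: s f g => //= x s IHs f g efg; rewrite efg (IHs _ (fun t => g (x :: t))).
Qed.

Lemma eq_cobd_subseq (T : eqType) (f g : seq T -> R) s :
    (forall t, subseq t s -> (size t).+1 = size s -> f t = g t) ->
  cobd f s = cobd g s.
Proof.
elim: s f g => [//|x s IHs] f g efg /=.
congr (_ - _); first by apply: efg; rewrite ?subseq_cons.
by apply: IHs => t sts szt; apply: efg; rewrite /= ?eqxx ?szt.
Qed.

Lemma cobdB (T : Type) (f g : seq T -> R) s :
  cobd (fun t => f t - g t) s = cobd f s - cobd g s.
Proof.
elim: s f g => [|x s IHs] f g /=; first by rewrite subrr.
by rewrite IHs; ring.
Qed.

Lemma cobd0 (T : Type) s : cobd (fun _ : seq T => 0) s = 0.
Proof. by elim: s => //= x s ->; rewrite subrr. Qed.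

Lemma cobd_sum (T : Type) (I : finType) (f : I -> seq T -> R) s :
  cobd (fun t => \sum_i f i t) s = \sum_i cobd (f i) s.
Proof.
elim: s f => [|x s IHs] f /=; first by rewrite big1.
by rewrite IHs sumrB.
Qed.

Lemma cobd_cobd (T : Type) (f : seq T -> R) s : cobd (cobd f) s = 0.
Proof. by elim: s f => //= x s IHs f; rewrite cobdB IHs subr0 subrr. Qed.

Lemma cobd_map (T U : Type) (h : T -> U) (f : seq U -> R) s :
  cobd f (map h s) = cobd (fun t => f (map h t)) s.
Proof. by elim: s f => //= x s IHs f; rewrite IHs. Qed.

(* Pullback of cochains along barycentric subdivision: a simplex [s] is
   subdivided by coning its subdivided boundary from [s] itself.  Flags are
   listed from the largest face down, which removes all signs. *)
Fixpoint sd (T : Type) (j : nat) (f : seq (seq T) -> R) (s : seq T) : R :=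
  if j is j'.+1 then cobd (sd j' (fun u => f (s :: u))) s else f [::].

Lemma eq_sd (T : Type) j (f g : seq (seq T) -> R) s : f =1 g -> sd j f s = sd j g s.
Proof.
elim: j f g s => /= [|j IHj] f g s efg; first exact: efg.
by apply: eq_cobd => t; apply: IHj => u; apply: efg.
Qed.

Lemma sdB (T : Type) j (f g : seq (seq T) -> R) s :
  sd j (fun u => f u - g u) s = sd j f s - sd j g s.
Proof.
elim: j f g s => //= j IHj f g s; rewrite -cobdB.
by apply: eq_cobd => t; rewrite IHj.
Qed.

Lemma sd0 (T : Type) j s : sd j (fun _ : seq (seq T) => 0) s = 0.
Proof.
elim: j s => //= j IHj s; rewrite -[RHS](cobd0 s).
by apply: eq_cobd => t; rewrite IHj.
Qed.

Lemma sd_sum (T : Type) (I : finType) j (f : I -> seq (seq T) -> R) s :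
  sd j (fun u => \sum_i f i u) s = \sum_i sd j (f i) s.
Proof.
elim: j f s => //= j IHj f s; rewrite -cobd_sum.
by apply: eq_cobd => t; rewrite IHj.
Qed.

(** Subdivision is a cochain map: by induction the coned term of [cobd f] is itself a coboundary,
    and the outer [cobd] kills it. *)
Lemma sd_cobd (T : Type) j (f : seq (seq T) -> R) s :
  sd j.+1 (cobd f) s = cobd (sd j f) s.
Proof.
elim: j f s => [|j IHj] f s.
  by apply: eq_cobd => t /=; rewrite subr0.
rewrite -[LHS]/(cobd (sd j.+1 (fun u => f u - cobd (fun v => f (s :: v)) u)) s).
transitivity (cobd (fun t => sd j.+1 f t - cobd (sd j (fun v => f (s :: v))) t) s).
  by apply: eq_cobd => t; rewrite sdB IHj.
by rewrite cobdB cobd_cobd subr0.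
Qed.

Lemma sd_map (T U : Type) (h : T -> U) j (f : seq (seq U) -> R) s :
  sd j f (map h s) = sd j (fun u => f (map (map h) u)) s.
Proof.
elim: j f s => //= j IHj f s; rewrite cobd_map.
by apply: eq_cobd => t; rewrite IHj.
Qed.

Definition supseq (T : eqType) (s t : seq T) := subseq t s.

Lemma supseq_trans (T : eqType) : transitive (@supseq T).
Proof. by move=> s t u sts sus; apply: subseq_trans sus sts. Qed.

(** Each [cobd] deletes one entry, so [sd] only evaluates its cochain on full flags of faces, of
    sizes j down to 1. *)
Lemma eq_sd_flag (T : eqType) j (f g : seq (seq T) -> R) s :
    size s = j ->
    (forall u, size u = j -> path (@supseq T) s u -> all (predC1 [::]) u -> f u = g u) ->
  sd j f s = sd j g s.
Proof.
elim: j f g s => [|j IHj] f g s szs efg /=; first exact: efg.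
apply: eq_cobd_subseq => t sts szt.
apply: IHj => [|u szu pu nu]; first by apply/eqP; rewrite -eqSS szt szs.
apply: efg; rewrite /= ?szu ?nu ?andbT //; last by case: (s) szs.
rewrite {1}/supseq subseq_refl /=.
case: u pu {szu nu} => //= t' u /andP[t't ->]; rewrite andbT.
exact: subseq_trans t't sts.
Qed.

(** * Degenerate sequences *)

Definition repeats (T : eqType) (s : seq T) := ~~ sorted (fun x y => x != y) s.

Lemma repeats_cons (T : eqType) (x : T) s : repeats s -> repeats (x :: s).
Proof. by rewrite /repeats; case: s => //= y s; rewrite negb_and orbC => ->. Qed.

Lemma repeats2 (T : eqType) (x : T) s : repeats [:: x, x & s].
Proof. by rewrite /repeats /= eqxx. Qed.

Lemma repeats_map (T : eqType) (h : T -> T) s : injective h ->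
  repeats (map h s) = repeats s.
Proof.
move=> hI; rewrite /repeats sorted_map; congr (~~ _).
by apply: eq_sorted => x y /=; rewrite (inj_eq hI).
Qed.

(** The two faces that omit one of two equal neighbours cancel; every other face still has a
    repeat. *)
Lemma cobd_repeats (T : eqType) (f : seq T -> R) j s :
    (forall t, size t = j -> repeats t -> f t = 0) ->
  size s = j.+1 -> repeats s -> cobd f s = 0.
Proof.
elim: s f j => //= x s IHs f j fr [szs] rs.
have [rs'|nrs] := boolP (repeats s).
  case: j szs fr => [|j] szs fr; first by case: (s) szs rs'.
  rewrite fr // (IHs _ j) ?subrr // => t szt rt.
  by rewrite fr //= ?szt // repeats_cons.
case: s szs rs nrs {IHs} => [|y s] //= szs.
rewrite /repeats /= negb_and orbC => /orP[->//|]; rewrite negbK => /eqP <- _.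
rewrite opprB addrCA subrr addr0 -[RHS](cobd0 s).
apply: eq_cobd_subseq => t _ szt; rewrite fr //= ?szt ?szs //.
exact: repeats2.
Qed.

End Coboundary.

(** * Cochains with a Z_p-action *)

Section ZpCochains.
Local Open Scope ring_scope.
Variables (p : nat) (p_pr : prime p).

Definition point := ('F_p * nat)%type.
Implicit Types (a : 'F_p) (x : point) (s : seq point) (f g : seq point -> 'F_p).

Definition shift a x : point := (x.1 + a, x.2).

Lemma shiftD a b x : shift a (shift b x) = shift (a + b) x.
Proof. by rewrite /shift /= -addrA (addrC b). Qed.

Lemma shift0 x : shift 0 x = x.
Proof. by case: x => u i; rewrite /shift addr0. Qed.

Lemma shift_inj a : injective (shift a).
Proof. by move=> x y /(congr1 (shift (- a))); rewrite !shiftD addNr !shift0. Qed.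

Lemma map_shiftD a b s : map (shift a) (map (shift b) s) = map (shift (a + b)) s.
Proof. by rewrite -map_comp; apply: eq_map => x /=; rewrite shiftD. Qed.

Lemma map_shift0 s : map (shift 0) s = s.
Proof. by rewrite -[RHS]map_id; apply: eq_map => x; rewrite shift0. Qed.

Definition norm_cochain f s := \sum_a f (map (shift a) s).
Definition diff_cochain f s := f s - f (map (shift 1) s).
Definition alt_op (j : nat) := if odd j then norm_cochain else diff_cochain.

Lemma eq_alt_op j f g s :
  (forall a, f (map (shift a) s) = g (map (shift a) s)) -> alt_op j f s = alt_op j g s.
Proof.
move=> efg; rewrite /alt_op; case: odd; first by apply: eq_bigr => a _.
by rewrite /diff_cochain efg -{1}[s]map_shift0 efg map_shift0.
Qed.

Lemma alt_op_alt_op j f s : alt_op j (alt_op j.+1 f) s = 0.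
Proof.
rewrite /alt_op /=; case: odd => /=.
  rewrite /norm_cochain /diff_cochain sumrB [X in _ - X](reindex_inj (addIr (-1))) /=.
  rewrite -sumrB big1 // => a _.
  by rewrite map_shiftD [1 + _]addrC addrNK subrr.
rewrite /diff_cochain /norm_cochain (reindex_inj (addIr 1)) /= -sumrB big1 // => a _.
by rewrite map_shiftD subrr.
Qed.

Lemma cobd_alt_op j f s : cobd (alt_op j f) s = alt_op j (cobd f) s.
Proof.
rewrite /alt_op; case: odd.
  by rewrite cobd_sum; apply: eq_bigr => a _; rewrite cobd_map.
by rewrite cobdB -cobd_map.
Qed.

(* The value of a cochain on the chain z_j, where z_0 is a vertex and z_(j+1)
   is the cone with apex (0, j+1) over the norm or difference of z_j; then the
   boundary of z_(j+1) is the norm or difference of z_j. *)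
Fixpoint eval_z (j : nat) f : 'F_p :=
  if j is j'.+1 then eval_z j' (alt_op j (fun s => f ((0, j) :: s)))
  else f [:: (0, 0%N)].

(** A signed vector on n positions is the list of its nonzero entries as pairs of sign and position,
    the largest position first. *)
Definition desc (n : nat) s :=
  sorted (fun x y : point => y.2 < x.2)%N s && all (fun x => x.2 < n)%N s.

Lemma desc_subseq n s t : subseq t s -> desc n s -> desc n t.
Proof.
move=> ts /andP[ss sn]; apply/andP; split; last first.
  by apply/allP => x /(mem_subseq ts); apply: (allP sn).
apply: subseq_sorted ts ss => y x z /= xy yz; exact: ltn_trans yz xy.
Qed.

Lemma desc_shift n a s : desc n (map (shift a) s) = desc n s.
Proof. by rewrite /desc sorted_map all_map. Qed.

Lemma desc_cons n s b : desc n s -> desc n.+1 ((b, n) :: s).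
Proof.
rewrite /desc => /andP[ss sn] /=; rewrite ltnSn /=; apply/andP; split.
  by case: s ss sn => //= x s -> /andP[-> _].
by apply: sub_all sn => x; apply: ltnW.
Qed.

Lemma eq_eval_z j f g :
    (forall s, size s = j.+1 -> desc j.+1 s -> f s = g s) ->
  eval_z j f = eval_z j g.
Proof.
elim: j f g => /= [|j IHj] f g efg; first exact: efg.
apply: IHj => s szs ds; apply: eq_alt_op => a; apply: efg.
  by rewrite /= size_map szs.
by apply: desc_cons; rewrite desc_shift.
Qed.

Lemma eval_z0 j : eval_z j (fun _ => 0) = 0.
Proof.
elim: j => //= j IHj; rewrite -[RHS]IHj; apply: eq_eval_z => s _ _.
rewrite /alt_op; case: odd => /=; last by rewrite /diff_cochain subrr.
by rewrite /norm_cochain big1.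
Qed.

Lemma eval_zB j f g : eval_z j (fun s => f s - g s) = eval_z j f - eval_z j g.
Proof.
elim: j f g => //= j IHj f g; rewrite -IHj; apply: eq_eval_z => s _ _.
rewrite /alt_op; case: odd => /=; last by rewrite /diff_cochain; ring.
by rewrite /norm_cochain sumrB.
Qed.

Lemma sum_const_Fp (u : 'F_p) : \sum_(a : 'F_p) u = 0.
Proof. by rewrite sumr_const card_Fp // -mulr_natr pchar_Fp_0 ?mulr0. Qed.

(** The boundary of a cone is its base minus the cone over the boundary of the base; by induction
    the latter carries a product of a norm and a difference, which is zero. *)
Lemma eval_z_cobd j f : eval_z j.+1 (cobd f) = eval_z j (alt_op j.+1 f).
Proof.
elim: j f => [|j IHj] f.
  rewrite /= /alt_op /= /norm_cochain /=.
  (* The term at the apex is the same for all p signs, so it sums to zero in ['F_p]. *)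
  by rewrite sumrB sum_const_Fp subr0.
rewrite -[LHS]/(eval_z j.+1 (alt_op j.+2
  (fun s => f s - cobd (fun t => f ((0, j.+2) :: t)) s))).
transitivity (eval_z j.+1 (fun s => alt_op j.+2 f s
    - cobd (alt_op j.+2 (fun t => f ((0, j.+2) :: t))) s)).
  apply: eq_eval_z => s _ _; rewrite cobd_alt_op /alt_op; case: odd => /=.
    by rewrite /norm_cochain sumrB.
  by rewrite /diff_cochain; ring.
rewrite eval_zB IHj -[RHS]subr0; congr (_ - _); rewrite -(eval_z0 j).
by apply: eq_eval_z => s _ _; rewrite alt_op_alt_op.
Qed.

(** * Exactness of the alternating norm and difference operators *)

Definition head_sign s : 'F_p := (head (0, 0%N) s).1.

Definition Fp_lt (a b : 'F_p) := (nat_of_ord a < nat_of_ord b)%N.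

(* The action is free: sequences with first sign 0 represent the orbits, which
   makes the complex with alternating norm and difference maps exact. *)
Definition solve_op (j : nat) f s : 'F_p :=
  if odd j then (head_sign s == 0)%:R * f s
  else \sum_(a : 'F_p | Fp_lt a (- head_sign s)) f (map (shift a) s).

Lemma Fp_ltn (b : 'F_p) : (nat_of_ord b < p)%N.
Proof. by rewrite -[X in (_ < X)%N](Fp_cast p_pr) ltn_ord. Qed.

Lemma Fp_gt0 (b : 'F_p) : b != 0 -> (0 < nat_of_ord b)%N.
Proof. by rewrite lt0n; apply: contra => /eqP b0; apply/eqP/val_inj. Qed.

Lemma val_Fp_pred (b : 'F_p) : nat_of_ord (b - 1) = if b == 0 then p.-1 else (nat_of_ord b).-1.
Proof.
have p_gt0 := prime_gt0 p_pr.
have bp := Fp_ltn b.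
case: eqVneq => [->|b0].
  have -> : 0 - 1 = p.-1%:R :> 'F_p.
    by apply/eqP; rewrite eq_sym sub0r -addr_eq0 natr1 prednK // pchar_Fp_0.
  by rewrite val_Fp_nat // modn_small // prednK.
have vb0 := Fp_gt0 b0.
have -> : b - 1 = (nat_of_ord b).-1%:R.
  by rewrite -[in LHS](natr_Zp b) -[in LHS](prednK vb0) -natr1 addrK.
by rewrite val_Fp_nat // modn_small // (leq_ltn_trans (leq_pred _)).
Qed.

(** For the norm, one translate of [s] has head sign 0, and [f] is invariant by hypothesis. For the
    difference, the sums in [solve_op] telescope; when the head sign is 0 the range wraps around,
    and the vanishing norm closes the gap. *)
Lemma alt_op_solve j f s :
    s != [::] -> (forall a, alt_op j f (map (shift a) s) = 0) ->
  alt_op j.+1 (solve_op j.+1 f) s = f s.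
Proof.
move=> s_nil; have hs a : head_sign (map (shift a) s) = head_sign s + a.
  by case: (s) s_nil.
rewrite /alt_op /solve_op /=; case: odd => /=; last first.
  move=> df; rewrite /norm_cochain (bigD1 (- head_sign s)) //= hs subrr eqxx mul1r.
  rewrite big1 ?addr0 => [|a nas]; last first.
    by rewrite hs addrC addr_eq0 (negbTE nas) mul0r.
  have inv (k : nat) : f (map (shift k%:R) s) = f s.
    elim: k => [|k <-]; first by rewrite map_shift0.
    move/(_ k%:R)/eqP: df; rewrite /diff_cochain subr_eq0 => /eqP ->.
    by rewrite map_shiftD nat1r.
  by rewrite -[in LHS](natr_Zp (- head_sign s)) inv.
move=> /(_ 0); rewrite map_shift0 /diff_cochain /norm_cochain hs => nf.
set y := - head_sign s; have -> : - (head_sign s + 1) = y - 1 by rewrite opprD.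
rewrite [X in _ - X](reindex_inj (addIr (-1))) /=.
have -> : \sum_(a | Fp_lt (a - 1) (y - 1)) f (map (shift (a - 1)) (map (shift 1) s)) =
   \sum_(a | Fp_lt (a - 1) (y - 1)) f (map (shift a) s).
  by apply: eq_bigr => a _; rewrite map_shiftD addrNK.
case: (eqVneq y 0) => y0.
  rewrite big_pred0 ?sub0r => [|a]; last by rewrite y0 /Fp_lt ltn0.
  move/eqP: nf; rewrite (bigD1 0) //= map_shift0 addr_eq0 => /eqP ->.
  congr (- _); apply: eq_bigl => a; rewrite /Fp_lt !val_Fp_pred y0 eqxx.
  have ap := Fp_ltn a.
  case: eqVneq => [_|a0]; first by rewrite ltnn.
  have a_gt0 := Fp_gt0 a0.
  by move: ap a_gt0; lia.
have vy0 := Fp_gt0 y0.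
rewrite (bigD1 0) //= map_shift0 -[RHS]addr0 -addrA; congr (_ + _).
apply/eqP; rewrite subr_eq0; apply/eqP/eq_bigl => a; rewrite /Fp_lt !val_Fp_pred (negbTE y0).
have yp := Fp_ltn y.
case: (eqVneq a 0) => [_|a0]; first by rewrite andbF; apply/esym/negbTE; move: yp vy0; lia.
have a_gt0 := Fp_gt0 a0.
by move: vy0 a_gt0; rewrite andbT; lia.
Qed.
End ZpCochains.

(** * A Z_p-Tucker lemma *)

Section ZpTucker.
Local Open Scope ring_scope.
Variables (p : nat) (p_pr : prime p).
Local Notation point := (point p).
Implicit Types (a : 'F_p) (x : point) (s : seq point) (f g : seq point -> 'F_p).

Fixpoint theta (j : nat) : seq point -> 'F_p :=
  if j is j'.+1 then solve_op j (cobd (theta j')) else fun=> 1.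

(** The solvability condition holds because [alt_op j] commutes with [cobd] and, by induction, turns
    [theta j] into a coboundary, or into 0 when j = 0. *)
Lemma alt_op_theta j s : (j < size s)%N ->
  alt_op j.+1 (theta j.+1) s = cobd (theta j) s.
Proof.
elim: j s => [|j IHj] s szs; apply: alt_op_solve => //; try by case: (s) szs.
  move=> a; rewrite -cobd_alt_op -[RHS](cobd0 _ (map (shift a) s)).
  by apply: eq_cobd => t; rewrite /alt_op /= /diff_cochain subrr.
move=> a; rewrite -cobd_alt_op -[RHS](cobd_cobd (theta j) (map (shift a) s)).
apply: eq_cobd_subseq => t _ szt; apply: IHj.
by rewrite -ltnS szt size_map.
Qed.

Lemma theta_repeats j s : size s = j -> repeats s -> theta j s = 0.
Proof.
elim: j s => [|j IHj] s szs rs; first by case: (s) szs rs.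
have cr a : cobd (theta j) (map (shift a) s) = 0.
  apply: cobd_repeats IHj _ _; first by rewrite size_map.
  by rewrite repeats_map //; apply: shift_inj.
rewrite /= /solve_op; case: odd; last by rewrite big1.
by rewrite -[s in cobd _ s]map_shift0 cr mulr0.
Qed.

(** Chains are simplices of the first subdivision of the n-fold join of Z_p, and so vertices of the
    second, which carry the labels. Repetitions are allowed. *)
Definition chain (n : nat) (F : seq (seq point)) :=
  [&& F != [::], sorted (@supseq _) F & all (fun s => (s != [::]) && desc n s) F].

Lemma chain_subseq n F F' : subseq F' F -> F' != [::] -> chain n F -> chain n F'.
Proof.
move=> sF nF /and3P[_ so al]; apply/and3P; split=> //.
  exact: (subseq_sorted (@supseq_trans _)) sF so.
by apply/allP => s /(mem_subseq sF); apply: (allP al).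
Qed.

Lemma chain_flag n j s u :
  desc n s -> size u = j.+1 -> path (@supseq _) s u -> all (predC1 [::]) u -> chain n u.
Proof.
move=> ds szu pu nu; apply/and3P; split; first by case: (u) szu.
  exact: path_sorted pu.
apply/allP => t tu; have /= -> := allP nu t tu.
move: pu; rewrite path_sortedE; last exact: supseq_trans.
by case/andP=> /allP/(_ t tu) ts _; apply: desc_subseq ts ds.
Qed.

(** A doubly subdivided cochain only sees flags of chains, so facts about labels of chains
    suffice. *)
Lemma eq_sd_sd n j (f g : seq (seq (seq point)) -> 'F_p) s :
    desc n s -> size s = j.+1 ->
    (forall U, size U = j.+1 -> all (chain n) U -> sorted (@supseq _) U -> f U = g U) ->
  sd j.+1 (sd j.+1 f) s = sd j.+1 (sd j.+1 g) s.
Proof.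
move=> ds szs efg; apply: eq_sd_flag => // u szu pu nu.
have cu := chain_flag ds szu pu nu.
apply: eq_sd_flag => // U szU pU nU; apply: efg => //; last exact: path_sorted pU.
apply/allP => F FU; move: pU; rewrite path_sortedE; last exact: supseq_trans.
case/andP=> /allP/(_ F FU) sF _; apply: chain_subseq sF _ cu.
exact: (allP nU).
Qed.

(** The last hypothesis says that the labels along a flag of chains span a simplex of the d-fold
    join of Z_p. *)
Theorem Zp_tucker n d (l : seq (seq point) -> point) :
    (forall F, chain n F -> (l F).2 < d)%N ->
    (forall a F, chain n F -> l (map (map (shift a)) F) = shift a (l F)) ->
    (forall F F', chain n F -> chain n F' -> subseq F' F ->
       l F' = l F \/ ((l F').2 < (l F).2)%N) ->
  (n <= d)%N.
Proof.
move=> l_lt l_shift l_mono; rewrite leqNgt; apply/negP => dn.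
(* The pullback of [theta j] along the labelling and both subdivisions. *)
pose zeta j := sd j (sd j (fun U => theta j (map l U))).
have zeta_shift j a s : size s = j.+1 -> desc n s ->
    zeta j.+1 (map (shift a) s) =
    sd j.+1 (sd j.+1 (fun U => theta j.+1 (map (shift a) (map l U)))) s.
  move=> szs ds; rewrite /zeta sd_map.
  transitivity (sd j.+1 (sd j.+1 (fun U =>
      theta j.+1 (map l (map (map (map (shift a))) U)))) s).
    by apply: eq_sd => u; rewrite sd_map.
  apply: (@eq_sd_sd n) => // U _ cU _; congr (theta _ _).
  rewrite -!map_comp; apply/eq_in_map => F FU /=.
  by apply: l_shift; apply: (allP cU).
have zeta_cobd j s : size s = j.+1 -> desc n s ->
    cobd (zeta j) s = alt_op j.+1 (zeta j.+1) s.
  move=> szs ds; rewrite /zeta -sd_cobd.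
  transitivity (sd j.+1 (sd j.+1 (fun U => alt_op j.+1 (theta j.+1) (map l U))) s).
    transitivity (sd j.+1 (sd j.+1 (cobd (fun U => theta j (map l U)))) s).
      by apply: eq_sd => u; rewrite sd_cobd.
    apply: (@eq_sd_sd n) => // U szU _ _.
    by rewrite -cobd_map alt_op_theta ?size_map ?szU.
  rewrite /alt_op; case: (odd _); rewrite /norm_cochain /diff_cochain.
    transitivity (\sum_a
        sd j.+1 (sd j.+1 (fun U => theta j.+1 (map (shift a) (map l U)))) s).
      by rewrite -sd_sum; apply: eq_sd => u; rewrite sd_sum.
    by apply: eq_bigr => a _; rewrite -zeta_shift.
  rewrite -[X in _ - X]/(zeta j.+1 _) zeta_shift //.
  by rewrite -sdB; apply: eq_sd => u; rewrite sdB.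
have widen j s : (j <= n)%N -> desc j s -> desc n s.
  move=> jn /andP[ss sn]; apply/andP; split=> //.
  by apply: sub_all sn => x xj; apply: leq_trans jn.
(* The value 1 is [theta 0] on the empty sequence; [zeta_cobd] and [eval_z_cobd] carry it from each
   degree to the next. *)
have key j : (j < n)%N -> eval_z j (alt_op j.+1 (zeta j.+1)) = 1.
  elim: j => [|j IHj] jn.
    rewrite -(@eq_eval_z _ _ (cobd (zeta 0%N))) /= ?subr0 // => s szs ds.
    by apply: zeta_cobd => //; apply: widen ds.
  rewrite -[RHS]IHj ?(ltnW jn) // -[RHS](eval_z_cobd p_pr); apply: eq_eval_z => s szs ds.
  by apply/esym/zeta_cobd => //; apply: widen ds.
case: n dn l_lt l_shift l_mono zeta_shift zeta_cobd widen key => // n.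
rewrite ltnS => dn l_lt _ l_mono _ _ _ /(_ n (ltnSn n)) /eqP; apply/negP.
rewrite (@eq_eval_z _ _ _ (fun=> 0)) ?eval_z0 1?eq_sym ?oner_eq0 // => s szs ds.
suff z0 a : zeta n.+1 (map (shift a) s) = 0.
  rewrite /alt_op; case: odd; first by rewrite /norm_cochain big1.
  by rewrite /diff_cochain z0 -[s in zeta _ s]map_shift0 z0 subrr.
have {}ds : desc n.+1 (map (shift a) s) by rewrite desc_shift.
rewrite /zeta (@eq_sd_sd n.+1 n _ (fun=> 0)) ?size_map //.
  by rewrite -[RHS](sd0 _ n.+1 (map (shift a) s)); apply: eq_sd => u; rewrite sd0.
(* Without a repeat, n + 1 labels along a flag would have strictly decreasing levels, but at most n
   levels exist. *)
move=> U szU cU soU; apply: theta_repeats; first by rewrite size_map.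
apply/negP => nrep.
have : sorted (fun x y : point => y.2 < x.2)%N (map l U).
  move: nrep soU cU {szU}; elim: U => //= F [|F' U] //= IHU /andP[nFF' nU] /andP[sFF' sU].
  move=> /andP[cF cU]; rewrite IHU // andbT.
  case/andP: cU => cF' _; case: (l_mono _ _ cF cF' sFF') => // eF.
  by rewrite eF eqxx in nFF'.
move=> so2; have so : sorted (fun i k : nat => k < i)%N (map snd (map l U)).
  by rewrite sorted_map.
have uq : uniq (map snd (map l U)).
  apply: sorted_uniq so; first by move=> y x z /= xy yz; apply: ltn_trans yz xy.
  by move=> x; rewrite /= ltnn.
have : (size (map snd (map l U)) <= size (iota 0 d))%N.
  apply: uniq_leq_size uq _ => i /mapP[x /mapP[F FU ->] ->].
  by rewrite mem_iota l_lt //; apply: (allP cU).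
by rewrite !size_map szU size_iota ltnNge dn.
Qed.

End ZpTucker.

(** * The prime case *)

(** Once s < k, the bound on intersections forces the members to be distinct, so such a family is a
    monochromatic edge. *)
Definition mono_family (T I : finType) (k s m : nat) (c : {set T} -> 'I_m)
    (j : 'I_m) (f : {ffun I -> {set T}}) :=
  [forall a, (#|f a| == k) && (c (f a) == j)] &&
  [forall a, forall b, (a != b) ==> (#|f a :&: f b| <= s)%N].

Lemma card_bigcup_le (T I : finType) (A : I -> {set T}) q :
  (forall i, #|A i| <= q)%N -> (#|\bigcup_i A i| <= #|I| * q)%N.
Proof.
move=> Aq; apply: (@leq_trans (\sum_i #|A i|)); last first.
  by rewrite -sum_nat_const; apply: leq_sum.
elim/big_rec2: _ => [|i u B _ le]; first by rewrite cards0.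
by apply: leq_trans (leq_card_setU _ _) _; rewrite leq_add2l.
Qed.

Lemma subset_of_card (T : finType) (A : {set T}) q :
  (q <= #|A|)%N -> exists2 B : {set T}, B \subset A & #|B| = q.
Proof.
move=> qA; exists [set x in take q (enum A)].
  by apply/subsetP => x; rewrite inE => /mem_take; rewrite mem_enum.
rewrite cardsE (card_uniqP _) ?take_uniq ?enum_uniq //.
by rewrite size_take -cardE; case: ltngtP qA.
Qed.

Section PrimeCase.
Local Open Scope ring_scope.
Variables (p : nat) (p_pr : prime p) (n k s m : nat) (c : {set 'I_n} -> 'I_m).
Hypotheses (s_lt_k : (s < k)%N) (n_ge : (p * (k - 1) + 1 <= n)%N).

Local Notation point := (point p).
Implicit Types (X Y : seq point) (F : seq (seq point)) (a b : 'F_p) (B : {set 'I_n}).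

(** * Signed vectors and their candidate sets *)

Definition supp X : {set 'I_n} := [set i | nat_of_ord i \in map snd X].
Definition part X a : {set 'I_n} := [set i | (a, nat_of_ord i) \in X].

Lemma desc_snd_inj X x y : desc n X -> x \in X -> y \in X -> x.2 = y.2 -> x = y.
Proof.
case/andP=> sX _; have tr : transitive (fun x y : point => y.2 < x.2)%N.
  by move=> v u w /= uv vw; apply: ltn_trans vw uv.
elim: X sX => //= z X IHX; rewrite path_sortedE // => /andP[/allP zX sX].
rewrite !inE => /predU1P[->|xX] /predU1P[->|yX] //; last exact: IHX.
  by move=> e; have:= zX _ yX; rewrite e ltnn.
by move=> e; have:= zX _ xX; rewrite e ltnn.
Qed.

Lemma card_supp X : desc n X -> #|supp X| = size X.
Proof.
move=> dX; rewrite cardE -(size_map val) -(size_map snd X); apply: perm_size.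
apply: uniq_perm.
- by rewrite map_inj_uniq ?enum_uniq //; apply: val_inj.
- case/andP: dX => sX _; apply: (@sorted_uniq _ (fun i j : nat => j < i)%N).
  + by move=> v u w /= uv vw; apply: ltn_trans vw uv.
  + by move=> x; rewrite /= ltnn.
  by rewrite sorted_map.
move=> i; apply/mapP/idP => [[j]|iX]; first by rewrite mem_enum inE => jX ->.
have i_lt : (i < n)%N by case/andP: dX => _ /allP nX; case/mapP: iX => x /nX xn ->.
by exists (Ordinal i_lt); rewrite ?mem_enum ?inE.
Qed.

Lemma supp_shift a X : supp (map (shift a) X) = supp X.
Proof. by apply/setP => i; rewrite !inE -map_comp. Qed.

Lemma part_shift a b X : part (map (shift a) X) (b + a) = part X b.
Proof.
apply/setP => i; rewrite !inE.
by rewrite -[(_ + _, _)]/(shift a (b, nat_of_ord i)) mem_map //; apply: shift_inj.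
Qed.

Definition cand X a B :=
  [&& #|B| == k, B :&: supp X \subset part X a & (#|B :\: supp X| <= s)%N].

Lemma cand_shift X a b B : cand (map (shift a) X) (b + a) B = cand X b B.
Proof. by rewrite /cand supp_shift part_shift. Qed.

(* Below [X], the sets [A] and [B] lie in the different parts [Y^a] and [Y^b],
   so they only share elements of [A] outside the support of [X]. *)
Lemma cand_inter X Y a b A B :
    subseq X Y -> desc n Y -> a != b -> cand X a A -> cand Y b B ->
  (#|A :&: B| <= s)%N.
Proof.
move=> sXY dY ab /and3P[_ /subsetP AX As] /and3P[_ /subsetP BY _].
apply: leq_trans As; apply/subset_leq_card/subsetP => i /setIP[iA iB].
rewrite in_setD iA andbT; apply/negP => iX.
have /mem_subseq sXY' := sXY.
have iYa : (a, nat_of_ord i) \in Y.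
  by apply: sXY'; have := AX i; rewrite !inE iA => ->//; move: iX; rewrite inE.
have iYb : (b, nat_of_ord i) \in Y.
  have := BY i; rewrite !inE iB => ->//; apply/mapP.
  by exists (a, nat_of_ord i).
by move/eqP: ab; apply; case: (desc_snd_inj dY iYa iYb erefl).
Qed.

(** The lowest [alpha] levels of labels are reserved for chains without a large vector. *)
Definition alpha := (p * (k - s - 1))%N.
Definition large X := (alpha < size X)%N.

(** As many elements as possible, at most s, are taken outside the support; the pigeonhole principle
    finds the others in one part. If fewer than s lie outside, the support is so large that [n_ge]
    supplies the count. *)
Lemma cand_exists X : desc n X -> large X -> exists a B, cand X a B.
Proof.
rewrite /large /alpha => dX; rewrite -(card_supp dX) => lX.
have p_gt0 := prime_gt0 p_pr.
have suppCn : (#|supp X| + #|~: supp X| = n)%N by rewrite cardsC card_ord.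
pose t := minn s #|~: supp X|.
have tk : (t < k)%N by rewrite (leq_ltn_trans (geq_minl _ _)).
have big : (p * (k - t - 1) < #|supp X|)%N.
  rewrite /t /minn; case: (ltnP s) => // le.
  move: le suppCn; move: #|~: supp X| => u le suppCn.
  have : (p * (k - u - 1) + p * u <= p * (k - 1))%N.
    by rewrite -mulnDr leq_mul2l; apply/orP; right; lia.
  have : (u <= p * u)%N by rewrite leq_pmull.
  by lia.
have /existsP[a ha] : [exists a, k - t <= #|part X a|]%N.
  rewrite -[[exists _, _]]negbK negb_exists; apply/negP => /forallP small.
  move: big; rewrite ltnNge -{1}(card_Fp p_pr) => /negP; apply.
  apply: leq_trans (card_bigcup_le (A := part X) _); last first.
    by move=> a; have := small a; rewrite -ltnNge => ?; rewrite subn1 -ltnS prednK // subn_gt0.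
  apply/subset_leq_card/subsetP => i; rewrite inE => /mapP[[a j] aX /= ei].
  by apply/bigcupP; exists a => //; rewrite inE ei.
have [A sA cA] := subset_of_card ha.
have [S sS cS] := subset_of_card (geq_minr s #|~: supp X|).
have subA : A \subset supp X.
  apply: subset_trans sA _; apply/subsetP => i; rewrite !inE => aX.
  by apply/mapP; exists (a, nat_of_ord i).
exists a, (A :|: S); apply/and3P; split.
- rewrite cardsU disjoint_setI0 ?cards0 ?subn0 ?cA ?cS -/t.
    by apply/eqP; lia.
  by rewrite disjoints_subset (subset_trans subA) // -setCS setCK.
- rewrite setIUl subUset (subset_trans (subsetIl _ _) sA) /=.
  rewrite (_ : S :&: supp X = set0) ?sub0set //.
  by apply/disjoint_setI0; rewrite disjoints_subset.
rewrite setDUl (_ : A :\: supp X = set0) ?set0U; last by apply/eqP; rewrite setD_eq0.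
by rewrite (leq_trans (subset_leq_card (subsetDl _ _))) // cS geq_minl.
Qed.

(** * Colours and signs along a chain *)

Definition has_cand F (j : nat) a B :=
  (nat_of_ord (c B) == j) && has (fun X => large X && cand X a B) F.
Definition signs F (j : nat) : {set 'F_p} := [set a | [exists B, has_cand F j a B]].
(** The empty maximum is 0, so this is meaningful only for chains with a large vector. *)
Definition top_colour F := \max_(j < m | signs F j != set0) nat_of_ord j.

Lemma signs_shift a F j : signs (map (map (shift a)) F) j = [set b + a | b in signs F j].
Proof.
apply/setP => b; apply/idP/imsetP => [|[b' hb ->]]; last first.
  move: hb; rewrite !inE => /existsP[B /andP[cB /hasP[X XF /andP[lX hX]]]].
  apply/existsP; exists B; rewrite /has_cand cB; apply/hasP.
  by exists (map (shift a) X); rewrite ?map_f // cand_shift /large size_map -/(large X) lX.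
rewrite inE => /existsP[B /andP[cB /hasP[Y /mapP[X XF ->]]]].
rewrite /large size_map -/(large X) -{1}(subrK a b) cand_shift => lX.
exists (b - a); rewrite ?subrK // inE; apply/existsP; exists B.
by rewrite /has_cand cB; apply/hasP; exists X.
Qed.

Lemma card_signs_shift a F j : #|signs (map (map (shift a)) F) j| = #|signs F j|.
Proof. by rewrite signs_shift card_imset //; apply: addIr. Qed.

Lemma top_colour_shift a F : top_colour (map (map (shift a)) F) = top_colour F.
Proof. by apply: eq_bigl => j; rewrite -!card_gt0 card_signs_shift. Qed.

Lemma signs_subseq F F' j : subseq F' F -> signs F' j \subset signs F j.
Proof.
move=> sF; apply/subsetP => a; rewrite !inE => /existsP[B /andP[cB /hasP[X XF hX]]].
apply/existsP; exists B; rewrite /has_cand cB; apply/hasP; exists X => //.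
exact: (mem_subseq sF).
Qed.

Lemma top_colour_subseq F F' : subseq F' F -> (top_colour F' <= top_colour F)%N.
Proof.
move=> sF; apply/bigmax_leqP => j hj.
apply: (leq_bigmax_cond (P := fun j : 'I_m => signs F j != set0)).
by apply: contra hj; rewrite -!subset0; apply: subset_trans (signs_subseq _ sF).
Qed.

Lemma top_colourP F : chain n F -> has large F ->
  (top_colour F < m)%N /\ signs F (top_colour F) != set0.
Proof.
case/and3P=> _ _ /allP aF /hasP[X XF lX]; have /andP[_ dX] := aF _ XF.
have [a [B hB]] := cand_exists dX lX.
have h : (0 < #|[pred j : 'I_m | signs F j != set0]|)%N.
  apply/card_gt0P; exists (c B); rewrite inE; apply/set0Pn; exists a; rewrite inE.
  by apply/existsP; exists B; rewrite /has_cand eqxx; apply/hasP; exists X; rewrite ?lX.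
rewrite /top_colour; have [j hj ->] := eq_bigmax_cond (fun j : 'I_m => nat_of_ord j) h.
by split=> //; rewrite inE in hj.
Qed.

Lemma supseq_chain_total F X Y : chain n F -> X \in F -> Y \in F ->
  subseq X Y || subseq Y X.
Proof.
case/and3P=> _ so _ XF YF; rewrite orbC.
have mono := sorted_leq_nth (@supseq_trans _) (@subseq_refl _) [::] so.
rewrite -(nth_index [::] XF) -(nth_index [::] YF).
case/orP: (leq_total (index X F) (index Y F)) => le; apply/orP.
  by left; apply: mono; rewrite ?inE ?index_mem.
by right; apply: mono; rewrite ?inE ?index_mem.
Qed.

(** Candidates for different signs come from comparable vectors of the chain, so [cand_inter] bounds
    their intersection. *)
Lemma signs_full F (j : 'I_m) : chain n F -> signs F j = setT ->
  exists f : {ffun 'F_p -> {set 'I_n}}, mono_family k s c j f.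
Proof.
move=> cF full.
have ex a : exists B, has_cand F j a B by apply/existsP; have := in_setT a; rewrite -full inE.
exists [ffun a => xchoose (ex a)]; apply/andP; split.
  apply/forallP => a; rewrite ffunE; have /andP[/eqP cB] := xchooseP (ex a).
  case/hasP=> X _ /andP[_ /and3P[-> _ _]] /=.
  by apply/eqP/val_inj.
apply/forallP => a; apply/forallP => b; apply/implyP => ab; rewrite !ffunE.
have /andP[_ /hasP[X XF /andP[_ hX]]] := xchooseP (ex a).
have /andP[_ /hasP[Y YF /andP[_ hY]]] := xchooseP (ex b).
have dF Z : Z \in F -> desc n Z by case/and3P: cF => _ _ /allP aF /aF/andP[].
case/orP: (supseq_chain_total cF XF YF) => sXY.
  exact: cand_inter sXY (dF _ YF) ab hX hY.
by rewrite setIC; apply: cand_inter sXY (dF _ XF) _ hY hX; rewrite eq_sym.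
Qed.

(* The average is the equivariant choice of an element for a nonempty proper
   set of signs; this is where the primality of [p] enters. *)
Definition label F : point :=
  if has large F then
    let S := signs F (top_colour F) in
    ((\sum_(a in S) a) / #|S|%:R, (alpha + top_colour F * (p - 1) + #|S|.-1)%N)
  else (head_sign (head [::] F), (size (head [::] F)).-1).

Theorem mono_family_prime : (m * (p - 1) + alpha < n)%N ->
  exists (j : 'I_m) (f : {ffun 'F_p -> {set 'I_n}}), mono_family k s c j f.
Proof.
move=> n_gt.
have [/existsP[j /existsP[f hf]]|nomono] :=
  boolP [exists j : 'I_m, exists f : {ffun 'F_p -> {set 'I_n}}, mono_family k s c j f].
  by exists j, f.
have card_signs F : chain n F -> has large F -> (0 < #|signs F (top_colour F)| < p)%N.
  move=> cF lF; have [jm S0] := top_colourP cF lF.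
  rewrite card_gt0 S0 /= -[X in (_ < X)%N](card_Fp p_pr) -cardsT.
  rewrite proper_card // properEneq subsetT andbT; apply: contra nomono => /eqP full.
  apply/existsP; exists (Ordinal jm); apply/existsP.
  exact: (@signs_full F (Ordinal jm) cF full).
have head_chain F : chain n F ->
    [/\ head [::] F \in F, head [::] F != [::] & (~~ has large F -> size (head [::] F) <= alpha)%N].
  case: F => [|X F] // /and3P[_ _ /= /andP[/andP[nX _] _]].
  by split; rewrite ?mem_head //= negb_or -leqNgt => /andP[].
suff: (n <= alpha + m * (p - 1))%N by lia.
apply: (Zp_tucker p_pr (l := label)) => [F cF|a F cF|F F' cF cF' sF].
(* Each colour owns p - 1 consecutive levels, as the set of signs has between 1 and p - 1
   elements. *)
- rewrite /label; case: ifPn => lF /=.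
    have /andP[S0 Sp] := card_signs F cF lF; have [jm _] := top_colourP cF lF.
    have : ((top_colour F).+1 * (p - 1) <= m * (p - 1))%N by rewrite leq_mul2r jm orbT.
    rewrite mulSn; move: S0 Sp; move: #|_| (top_colour F * _)%N (m * _)%N => q u v.
    by lia.
  have [_ nX /(_ lF)] := head_chain F cF.
  case: (head [::] F) nX => //= x X _ szX.
  exact: leq_trans szX (leq_addr _ _).
- have has_shift : has large (map (map (shift a)) F) = has large F.
    by rewrite has_map; apply: eq_has => X; rewrite /large /= size_map.
  rewrite /label has_shift; case: ifPn => lF.
    rewrite top_colour_shift card_signs_shift /shift /=; congr (_, _).
    have /andP[S0 Sp] := card_signs F cF lF.
    rewrite signs_shift big_imset /=; last by move=> u v _ _; apply: addIr.
    (* The sum grows by a times the number of signs, which is invertible modulo p. *)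
    rewrite big_split /= sumr_const mulrDl -[a *+ _]mulr_natr mulfK //.
    rewrite -(dvdn_pcharf (pchar_Fp p_pr)); apply/negP => /(dvdn_leq S0).
    by rewrite leqNgt Sp.
  have [XF nX _] := head_chain F cF.
  by case: F {has_shift lF cF} XF nX => // -[|x X] F //= _ _; rewrite size_map.
(* If [F'] has no large vector, its level is below [alpha]. If [F] has none either, the head of [F']
   is a subsequence of the head of [F], so equal sizes mean equal heads. *)
rewrite /label; case: (boolP (has large F')) => lF'; last first.
  have [X'F nX' /(_ lF') szX'] := head_chain F' cF'.
  case: ifPn => lF.
    right => /=; move: szX' nX'; case: (head _ _) => //= x X szX _.
    by rewrite -addnA (leq_trans szX) // leq_addr.
  have [XF nX /(_ lF) szX] := head_chain F cF.
  have sX : subseq (head [::] F') (head [::] F).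
    have := mem_subseq sF X'F; case/and3P: cF => _ + _.
    case: (F) => //= Z G; rewrite path_sortedE; last exact: supseq_trans.
    by case/andP=> /allP ZG _; rewrite inE => /predU1P[->//|/ZG].
  case: (eqVneq (size (head [::] F')) (size (head [::] F))) => [esz|nsz].
    left; suff -> : head [::] F' = head [::] F by [].
    by apply/eqP; rewrite -(size_subseq_leqif sX) esz.
  right => /=; have := size_subseq sX; rewrite leq_eqVlt (negbTE nsz) /=.
  by case: (head [::] F') nX' => //= x X' _; case: (head [::] F).
have lF : has large F by case/hasP: lF' => X /(mem_subseq sF) XF lX; apply/hasP; exists X.
rewrite lF; have /andP[S0 Sp] := card_signs F cF lF.
have /andP[S0' Sp'] := card_signs F' cF' lF'.
(* Passing from [F'] to [F] can only raise the top colour or, at equal top colour, enlarge its set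
   of signs; if neither changes, the labels agree. *)
have := top_colour_subseq sF; rewrite leq_eqVlt => /orP[/eqP eJ|ltJ]; last first.
  right => /=.
  have : ((top_colour F').+1 * (p - 1) <= top_colour F * (p - 1))%N.
    by rewrite leq_mul2r ltJ orbT.
  rewrite mulSn; move: S0' Sp' S0 Sp.
  move: #|_| #|_| (top_colour F' * _)%N (top_colour F * _)%N => q q' u v.
  by lia.
rewrite eJ in S0' Sp' *; have sS := signs_subseq (top_colour F) sF.
case: (eqVneq #|signs F' (top_colour F)| #|signs F (top_colour F)|) => [eS|nS].
  left; suff -> : signs F' (top_colour F) = signs F (top_colour F) by [].
  by apply/eqP; rewrite eqEcard sS eS leqnn.
right => /=; have := subset_leq_card sS; rewrite leq_eqVlt (negbTE nS) /=.
by move=> lt; rewrite ltn_add2l -ltnS !prednK.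
Qed.

End PrimeCase.

(** * Products and the general case *)

(** Stated relative to a subset [Y] of any finite type, so that it can be applied inside the members
    of another family. *)
Definition family_bound (r : nat) :=
  forall (T : finType) (Y : {set T}) (k s m : nat) (c : {set T} -> 'I_m),
    s < k -> r * (k - 1) + 1 <= #|Y| -> m * (r - 1) + r * (k - s - 1) < #|Y| ->
  exists (j : 'I_m) (f : {ffun 'I_r -> {set T}}),
    mono_family k s c j f && [forall i, f i \subset Y].

Lemma mono_family_transfer (T T' I I' : finType) (phi : T' -> T) (h : I' -> I)
    k s m (c : {set T} -> 'I_m) j (f : {ffun I -> {set T'}}) :
    injective phi -> injective h ->
    mono_family k s (fun B : {set T'} => c (phi @: B)) j f ->
  mono_family k s c j [ffun i => phi @: f (h i)].
Proof.
move=> phiI hI /andP[/forallP fk /forallP fs]; apply/andP; split.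
  by apply/forallP => i; rewrite ffunE card_imset // fk.
apply/forallP => i; apply/forallP => i'; apply/implyP => ii'; rewrite !ffunE.
rewrite -imsetI; last by move=> x y _ _; apply: phiI.
rewrite card_imset //; have /forallP/(_ (h i'))/implyP := fs (h i); apply.
by rewrite (inj_eq hI).
Qed.

Lemma family_bound_prime p : prime p -> family_bound p.
Proof.
move=> p_pr T Y k s m c sk n_ge n_gt.
have [j [f hf]] := @mono_family_prime p p_pr #|Y| k s m
  (fun B => c (@enum_val T (mem Y) @: B)) sk n_ge n_gt.
pose h (i : 'I_p) : 'F_p := enum_val (cast_ord (esym (card_Fp p_pr)) i).
have hI : injective h by move=> i i' /enum_val_inj/cast_ord_inj.
exists j, [ffun i => @enum_val T (mem Y) @: f (h i)].
rewrite mono_family_transfer //=; last exact: enum_val_inj.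
apply/forallP => i; rewrite ffunE; apply/subsetP => x /imsetP[y _ ->].
exact: enum_valP.
Qed.

(** Sets chosen inside one block share at most s elements by the choice of their family, those in
    different blocks because the blocks do. *)
Lemma family_bound_mul r1 r2 : 1 < r1 -> 1 < r2 ->
  family_bound r1 -> family_bound r2 -> family_bound (r1 * r2).
Proof.
move=> r1_gt1 r2_gt1 bd1 bd2 T Y k s m c sk n_ge n_gt.
(* The least [w] for which the bound for [r1] applies inside sets of size [w.+1]. *)
pose w := maxn (m * (r1 - 1) + r1 * (k - s - 1)) (r1 * (k - 1)).
pose inside (Z : {set T}) j (f : {ffun 'I_r1 -> {set T}}) :=
  mono_family k s c j f && [forall i, f i \subset Z].
(* The default [c Z] is never reached on sets of size [w.+1]. *)
pose c' Z := if [pick j | [exists f, inside Z j f]] is Some j then j else c Z.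
have ws : s < w.+1.
  by rewrite ltnS leq_max; apply/orP; right; apply: leq_trans (leq_pmull _ _); lia.
have [w_ge w_gt] : r2 * w + 1 <= #|Y| /\ m * (r2 - 1) + r2 * (w - s) < #|Y|.
  rewrite {}/w in ws *; move: #|Y| n_ge n_gt => N.
  have [q ->] : exists q, k = s + 1 + q by exists (k - s - 1); lia.
  have [u ->] : exists u, r1 = u.+1 by exists r1.-1; lia.
  have [v ->] : exists v, r2 = v.+1 by exists r2.-1; lia.
  have -> : s + 1 + q - 1 = s + q by lia.
  have -> : s + 1 + q - s - 1 = q by lia.
  have -> : u.+1 * v.+1 - 1 = u * v + u + v by lia.
  rewrite !subSS !subn0 => H1 H2.
  case: (leqP (m * u + u.+1 * q) (u.+1 * (s + q))) => le.
    split; first by nia.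
    have -> : u.+1 * (s + q) - s = u * s + u.+1 * q by nia.
    (* Here [w] is r1(k-1). For s <= m the hypothesis [H2] suffices; otherwise m v <= s v and [H1]
       does. *)
    by case: (leqP s m) => sm; nia.
  by split; nia.
have [j [g /andP[/andP[/forallP gk /forallP gs] /forallP gY]]] :
    exists (j : 'I_m) (f : {ffun 'I_r2 -> {set T}}),
      mono_family w.+1 s c' j f && [forall i, f i \subset Y].
  have e1 : w.+1 - 1 = w by lia.
  have e2 : w.+1 - s - 1 = w - s by lia.
  by apply: bd2; rewrite ?e1 ?e2.
have ex b : exists f, inside (g b) j f.
  have /andP[/eqP gw /eqP] := gk b; rewrite /c'; case: pickP => [j' /existsP[f hf] <-|no].
    by exists f.
  have [||j' [f hf]] := bd1 T (g b) k s m c sk.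
  - by rewrite gw addn1 ltnS leq_maxr.
  - by rewrite gw ltnS leq_maxl.
  by have /existsP[] := no j'; exists f.
pose h (i : 'I_(r1 * r2)) : 'I_r1 * 'I_r2 := enum_val
  (cast_ord (esym (etrans (card_prod _ _) (congr2 muln (card_ord r1) (card_ord r2)))) i).
have hI : injective h by move=> i i' /enum_val_inj/cast_ord_inj.
pose f b := xchoose (ex b).
have fP b : inside (g b) j (f b) := xchooseP (ex b).
exists j, [ffun i => f (h i).2 (h i).1]; apply/andP; split; last first.
  apply/forallP => i; rewrite ffunE; have /andP[_ /forallP fg] := fP (h i).2.
  exact: subset_trans (fg _) (gY _).
apply/andP; split.
  apply/forallP => i; rewrite ffunE; have /andP[/andP[/forallP fk _] _] := fP (h i).2.
  exact: fk.
apply/forallP => i; apply/forallP => i'; apply/implyP; rewrite !ffunE -(inj_eq hI).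
case: (h i) (h i') => [a b] [a' b'] /= ne.
have [eb|nb] := eqVneq b b'.
  have /andP[/andP[_ /forallP fs] _] := fP b; rewrite -eb.
  by have /forallP/(_ a')/implyP := fs a; apply; apply: contra ne => /eqP ->; rewrite eb.
have /andP[_ /forallP fb] := fP b; have /andP[_ /forallP fb'] := fP b'.
apply: leq_trans (subset_leq_card (setISS (fb a) (fb' a'))) _.
by have /forallP/(_ b')/implyP := gs b; apply.
Qed.

Theorem family_boundP r : 1 < r -> family_bound r.
Proof.
elim/ltn_ind: r => r IHr r_gt1; have [|r_npr] := boolP (prime r).
  exact: family_bound_prime.
have r_gt0 := ltnW r_gt1.
have q_gt1 : 1 < r %/ pdiv r.
  rewrite ltn_divRL ?pdiv_dvd // mul1n ltn_neqAle pdiv_leq // andbT.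
  by apply: contra r_npr => /eqP <-; apply: pdiv_prime.
have p_gt1 : 1 < pdiv r by rewrite prime_gt1 // pdiv_prime.
rewrite -(divnK (pdiv_dvd r)); apply: family_bound_mul => //; apply: IHr => //.
  by rewrite ltn_Pdiv.
by rewrite -[X in _ < X](divnK (pdiv_dvd r)) ltn_Pmull // pdiv_gt0.
Qed.

(* chi(KG^r(n,k,s)) >= ceil((n - r(k-s-1)) / (r-1)), stated as: every proper
   m-coloring has m >= ceil(...).  The ceiling of a/b (b >= 1) is
   (a + b - 1) %/ b; the nat subtractions are exact under the hypotheses. *)
Theorem theorem1 (k n r s : nat)
  (hn : r * (k - 1) + 1 <= n) (hks : s < k) (hr : 2 <= r) :
  forall (m : nat) (c : {set 'I_n} -> 'I_m),
    KG_proper_coloring k s r c ->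
    (n - r * (k - s - 1) + (r - 1) - 1) %/ (r - 1) <= m.
Proof.
move=> m c c_proper; rewrite leqNgt; apply/negP => m_lt.
have n_gt : m * (r - 1) + r * (k - s - 1) < #|[set: 'I_n]|.
  have le : r * (k - s - 1) <= r * (k - 1) by rewrite leq_mul2l; apply/orP; right; lia.
  (* Being below the ceiling means (m + 1)(r - 1) is at most the numerator, which is the strict
     inequality wanted. *)
  rewrite cardsT card_ord; move: m_lt; rewrite leq_divRL ?subn_gt0 // mulSn.
  by move: (m * (r - 1)) (r * (k - s - 1)) le => u v; lia.
have hn' : r * (k - 1) + 1 <= #|[set: 'I_n]| by rewrite cardsT card_ord.
have [j [f /andP[/andP[/forallP fk /forallP fs] _]]] := family_boundP hr c hks hn' n_gt.
have fI : injective f.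
  move=> a b eab; apply/eqP; apply/negPn/negP => ab.
  have /forallP/(_ b)/implyP/(_ ab) := fs a; rewrite -eab setIid.
  by have /andP[/eqP -> _] := fk a; rewrite leqNgt hks.
have [|X [Y [/imsetP[a _ ->] /imsetP[b _ ->]]]] := c_proper [set f a | a in 'I_r].
  apply/and3P; split.
  - by rewrite card_imset // card_ord.
  - by apply/forall_inP => X /imsetP[a _ ->]; have /andP[] := fk a.
  apply/forall_inP => X /imsetP[a _ ->]; apply/forall_inP => Y /imsetP[b _ ->].
  apply/implyP => ab; have /forallP/(_ b)/implyP := fs a; apply.
  by apply: contra ab => /eqP ->.
have /andP[_ /eqP ->] := fk a; have /andP[_ /eqP ->] := fk b.
by rewrite eqxx.
Qed.
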